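(* Let $\Omega\subseteq\mathbb H$ be an axially symmetric slice domain, let $c=(c_k)_{k\in\mathbb N}$ be a non-decreasing sequence of real numbers with $c_0=1$, and let $b_k=\frac{c_{k+2}}{(k+1)^2(k+2)^2}$ for $k\ge 0$. Set $\mathcal{HS}^0_c:=\{f\in\mathcal{HS}_c(\Omega):\ f(0)=f'(0)=0\}$. Then the Fueter mapping $\tau$ defines a right quaternionic linear operator from $\mathcal{HS}^0_c$ onto $\mathcal{HM}_b(\Omega)$ which is isometric up to a constant, i.e. there is a constant $C>0$ with $\|\tau(f)\|_{\mathcal{HM}_b(\Omega)}=C\,\|f\|_{\mathcal{HS}_c(\Omega)}$ for all $f\in\mathcal{HS}^0_c$.
   Context: $\mathbb H$ denotes the quaternions, $q=x_0+x_1i+x_2j+x_3k$; $\mathbb S=\{q\in\mathbb H:q^2=-1\}$, $\mathbb C_I=\mathbb R+I\mathbb R$ for $I\in\mathbb S$. A domain $\Omega\subseteq\mathbb H$ is a slice domain if $\Omega\cap\mathbb R\ne\emptyset$ and $\Omega\cap\mathbb C_I$ is connected for all $I\in\mathbb S$; it is axially symmetric if $x+Iy\in\Omega$ implies $x+Jy\in\Omega$ for all $J\in\mathbb S$. For $k\ge 0$, $Q_k(q)=\sum_{j=0}^k T^k_j\,q^{k-j}\overline q^{\,j}$ with $T^k_j=\frac{2(k-j+1)}{(k+1)(k+2)}$. The spaces consist of functions on $\Omega$ given by converging series: $$\mathcal{HS}_c(\Omega)=\left\{\sum_{k=0}^\infty q^kf_k:\ f_k\in\mathbb H,\ \sum_{k=0}^\infty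 c_k|f_k|^2<\infty\right\},\qquad \mathcal{HM}_b(\Omega)=\left\{\sum_{k=0}^\infty Q_k\alpha_k:\ \alpha_k\in\mathbb H,\ \sum_{k=0}^\infty b_k|\alpha_k|^2<\infty\right\},$$ with $\|\sum q^kf_k\|^2_{\mathcal{HS}_c(\Omega)}=\sum c_k|f_k|^2$ and $\|\sum Q_k\alpha_k\|^2_{\mathcal{HM}_b(\Omega)}=\sum b_k|\alpha_k|^2$. For $f=\sum q^kf_k$, $f(0)=f_0$ and $f'(0)=f_1$ (the slice derivative at $0$). The Fueter mapping is $\tau=\Delta_{\mathbb R^4}$, the Laplacian in the four real variables $x_0,x_1,x_2,x_3$. The sequence $b$ here need not be non-decreasing nor satisfy $b_0=1$. *)

(* Defs.v *)
From HB Require Import structures.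
From mathcomp Require Import all_boot all_order all_algebra.
From mathcomp Require Import ring.
From mathcomp Require Import all_classical all_reals all_analysis.

Set Implicit Arguments.
Unset Strict Implicit.
Unset Printing Implicit Defensive.

Import Order.TTheory GRing.Theory Num.Theory.
Import numFieldNormedType.Exports.

Local Open Scope classical_set_scope.
Local Open Scope ring_scope.

(* The quaternion x0 + x1 i + x2 j + x3 k is the row vector (x0, x1, x2, x3).
   The norm `|q| inherited from row vectors is the sup norm; it is used only
   through its topology.  The quaternionic modulus is qabs below. *)
Definition quat (R : realType) : Type := 'rV[R]_4.

HB.instance Definition _ (R : realType) := NormedModule.copy (quat R) 'rV[R]_4.
HB.instance Definition _ (R : realType) := Complete.copy (quat R) 'rV[R]_4.

Definition mkquat (R : realType) (a b c d : R) : quat R :=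
  \row_(i < 4) [:: a; b; c; d]`_i.

Definition qcoord (R : realType) (q : quat R) (n : nat) : R :=
  (q : 'rV[R]_4) ord0 (inord n).

Lemma quatP (R : realType) (p q : quat R) :
  qcoord p 0 = qcoord q 0 -> qcoord p 1 = qcoord q 1 ->
  qcoord p 2 = qcoord q 2 -> qcoord p 3 = qcoord q 3 -> p = q.
Proof.
move=> h0 h1 h2 h3; apply/rowP => i; rewrite -(inord_val i).
by case: i => [[|[|[|[|//]]]] ?].
Qed.

Lemma qcoord_mk (R : realType) (a b c d : R) (n : nat) :
  (n < 4)%N -> qcoord (mkquat a b c d) n = [:: a; b; c; d]`_n.
Proof. by move=> n4; rewrite /qcoord mxE inordK. Qed.

Lemma qcoordD (R : realType) (p q : quat R) n :
  qcoord (p + q) n = qcoord p n + qcoord q n.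
Proof. by rewrite /qcoord mxE. Qed.

Definition qone (R : realType) : quat R := mkquat 1 0 0 0.

(* Hamilton product: i^2 = j^2 = k^2 = ijk = -1 *)
Definition qmul (R : realType) (p q : quat R) : quat R :=
  let a n := qcoord p n in let b n := qcoord q n in
  mkquat (a 0 * b 0 - a 1 * b 1 - a 2 * b 2 - a 3 * b 3)
         (a 0 * b 1 + a 1 * b 0 + a 2 * b 3 - a 3 * b 2)
         (a 0 * b 2 - a 1 * b 3 + a 2 * b 0 + a 3 * b 1)
         (a 0 * b 3 + a 1 * b 2 - a 2 * b 1 + a 3 * b 0).

Lemma qmulA (R : realType) : associative (@qmul R).
Proof. by move=> p q r; apply: quatP; rewrite !qcoord_mk //=; ring. Qed.

Lemma qmul1l (R : realType) : left_id (@qone R) (@qmul R).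
Proof. by move=> q; apply: quatP; rewrite !qcoord_mk //=; ring. Qed.

Lemma qmul1r (R : realType) : right_id (@qone R) (@qmul R).
Proof. by move=> q; apply: quatP; rewrite !qcoord_mk //=; ring. Qed.

Lemma qmulDl (R : realType) : left_distributive (@qmul R) +%R.
Proof.
by move=> p q r; apply: quatP; rewrite !(qcoordD, qcoord_mk) //=; ring.
Qed.

Lemma qmulDr (R : realType) : right_distributive (@qmul R) +%R.
Proof.
by move=> p q r; apply: quatP; rewrite !(qcoordD, qcoord_mk) //=; ring.
Qed.

Lemma qone_neq0 (R : realType) : qone R != 0.
Proof.
apply/eqP => /(congr1 (fun q : quat R => qcoord q 0)).
by rewrite qcoord_mk //= /qcoord mxE => /eqP; rewrite oner_eq0.
Qed.

HB.instance Definition _ (R : realType) :=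
  GRing.Zmodule_isNzRing.Build (quat R) (@qmulA R) (@qmul1l R) (@qmul1r R)
    (@qmulDl R) (@qmulDr R) (@qone_neq0 R).

Lemma qcoordZ (R : realType) (x : R) (q : quat R) n :
  qcoord (x *: q) n = x * qcoord q n.
Proof. by rewrite /qcoord mxE. Qed.

Lemma qscaleAl (R : realType) (x : R) (p q : quat R) :
  x *: (p * q) = (x *: p) * q.
Proof.
by apply: quatP; rewrite !(qcoordZ, qcoord_mk) //=; ring.
Qed.

Lemma qscaleAr (R : realType) (x : R) (p q : quat R) :
  x *: (p * q) = p * (x *: q).
Proof.
by apply: quatP; rewrite !(qcoordZ, qcoord_mk) //=; ring.
Qed.

HB.instance Definition _ (R : realType) :=
  GRing.Lmodule_isLalgebra.Build R (quat R) (@qscaleAl R).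
HB.instance Definition _ (R : realType) :=
  GRing.Lalgebra_isAlgebra.Build R (quat R) (@qscaleAr R).

Definition qconj (R : realType) (q : quat R) : quat R :=
  mkquat (qcoord q 0) (- qcoord q 1) (- qcoord q 2) (- qcoord q 3).

Definition qabs (R : realType) (q : quat R) : R :=
  Num.sqrt (\sum_(i < 4) qcoord q i ^+ 2).

Definition imag_sphere (R : realType) : set (quat R) := [set q | q ^+ 2 = -1].

Definition real_line (R : realType) : set (quat R) :=
  [set q : quat R | exists x : R, q = x%:A].

Definition slice_plane (R : realType) (I : quat R) : set (quat R) :=
  [set q | exists x y : R, q = x%:A + y *: I].

Definition slice_domain (R : realType) (Omega : set (quat R)) : Prop :=
  [/\ open Omega, connected Omega, Omega `&` @real_line R !=set0 &
      forall I, imag_sphere I -> connected (Omega `&` slice_plane I)].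

Definition axially_symmetric (R : realType) (Omega : set (quat R)) : Prop :=
  forall (x y : R) (I : quat R), imag_sphere I -> Omega (x%:A + y *: I) ->
    forall J, imag_sphere J -> Omega (x%:A + y *: J).

Definition fueter_T (R : realType) (k j : nat) : R :=
  2 * (k - j).+1%:R / (k.+1%:R * k.+2%:R).

Definition fueter_Q (R : realType) (k : nat) (q : quat R) : quat R :=
  \sum_(j < k.+1) fueter_T R k j *: (q ^+ (k - j) * qconj q ^+ j).

(* Functions on Omega are total functions of which only the values on Omega
   matter.  [expands_on Omega e f a]: for every q in Omega the series
   \sum_k e_k(q) a_k, with coefficients on the right, converges to f(q). *)
Definition expands_on (R : realType) (Omega : set (quat R))
    (e : nat -> quat R -> quat R) (f : quat R -> quat R) (a : nat -> quat R)
    : Prop :=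
  forall q, Omega q -> series (fun k => e k q * a k) @ \oo --> f q.

Definition wterm (R : realType) (w : nat -> R) (a : nat -> quat R) (k : nat)
    : R := w k * qabs (a k) ^+ 2.

Definition weighted_space (R : realType) (Omega : set (quat R))
    (e : nat -> quat R -> quat R) (w : nat -> R) : set (quat R -> quat R) :=
  [set f | exists2 a, expands_on Omega e f a & cvgn (series (wterm w a))].

(* A coefficient sequence of f, chosen arbitrarily; on a slice domain it is
   unique for both e_k = q^k and e_k = Q_k. *)
Definition coefs (R : realType) (Omega : set (quat R))
    (e : nat -> quat R -> quat R) (f : quat R -> quat R) : nat -> quat R :=
  xget (fun=> 0) [set a | expands_on Omega e f a].

Definition weighted_norm (R : realType) (Omega : set (quat R))
    (e : nat -> quat R -> quat R) (w : nat -> R) (f : quat R -> quat R) : R :=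
  Num.sqrt (limn (series (wterm w (coefs Omega e f)))).

Definition qpow (R : realType) (k : nat) (q : quat R) : quat R := q ^+ k.

Definition HS (R : realType) (c : nat -> R) (Omega : set (quat R)) :=
  weighted_space Omega (@qpow R) c.

Definition HS_norm (R : realType) (c : nat -> R) (Omega : set (quat R)) :=
  weighted_norm Omega (@qpow R) c.

Definition HM (R : realType) (b : nat -> R) (Omega : set (quat R)) :=
  weighted_space Omega (@fueter_Q R) b.

Definition HM_norm (R : realType) (b : nat -> R) (Omega : set (quat R)) :=
  weighted_norm Omega (@fueter_Q R) b.

(* f(0) and f'(0) are by definition the first two coefficients of f, so that
   they make sense even if 0 is not in Omega. *)
Definition HS0 (R : realType) (c : nat -> R) (Omega : set (quat R))
    : set (quat R -> quat R) :=
  [set f | [/\ HS c Omega f, coefs Omega (@qpow R) f 0 = 0 &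
               coefs Omega (@qpow R) f 1 = 0]].

Definition qbasis (R : realType) (i : 'I_4) : quat R := delta_mx ord0 i.

Definition fueter_map (R : realType) (f : quat R -> quat R)
    : quat R -> quat R :=
  fun q => \sum_(i < 4) 'D_(qbasis R i) ('D_(qbasis R i) f) q.

(* 'D_v is a total operator with junk values; this says that the second
   partial derivatives occurring in fueter_map f exist on Omega. *)
Definition fueter_defined_on (R : realType) (Omega : set (quat R))
    (f : quat R -> quat R) : Prop :=
  forall q (i : 'I_4), Omega q ->
    derivable f q (qbasis R i) /\
    derivable ('D_(qbasis R i) f) q (qbasis R i).

Definition right_subspace (R : realType) (V : set (quat R -> quat R)) : Prop :=
  V (fun=> 0) /\
  forall f g p, V f -> V g -> V (fun q => f q * p + g q).

Definition right_linear_operator (R : realType) (Omega : set (quat R))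
    (V W : set (quat R -> quat R))
    (T : (quat R -> quat R) -> quat R -> quat R) : Prop :=
  [/\ right_subspace V, right_subspace W, (forall f, V f -> W (T f)) &
      forall f g p, V f -> V g -> forall q, Omega q ->
        T (fun q => f q * p + g q) q = T f q * p + T g q].

Definition onto_on (R : realType) (Omega : set (quat R))
    (V W : set (quat R -> quat R))
    (T : (quat R -> quat R) -> quat R -> quat R) : Prop :=
  forall g, W g -> exists2 f, V f & forall q, Omega q -> T f q = g q.

Definition fueter_weight (R : realType) (c : nat -> R) (k : nat) : R :=
  c k.+2 / (k.+1%:R ^+ 2 * k.+2%:R ^+ 2).

(* Main.v *)
Require Import Defs.
From mathcomp Require Import all_boot all_order all_algebra.
From mathcomp Require Import ring lra.
From mathcomp Require Import all_classical all_reals all_analysis.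
Set Implicit Arguments.
Unset Strict Implicit.
Unset Printing Implicit Defensive.
Import Order.TTheory GRing.Theory Num.Theory.
Import numFieldNormedType.Exports.
Local Open Scope classical_set_scope.
Local Open Scope ring_scope.

(** The Fueter map acts termwise on power series, and on monomials it is
    explicit: the Laplacian of [q ^+ k.+2] is
    [- (2 * k.+1 * k.+2) *: fueter_Q k q].  A series [f] with coefficients [a_k]
    is therefore sent to the series in the [fueter_Q k] with coefficients
    [- (2 * k.+1 * k.+2) *: a_(k+2)], and the weight [fueter_weight c] is tuned
    so that the squared norm of the image is [4] times that of [f] as soon as
    [a_0 = a_1 = 0].  This gives the isometry with constant [C = 2].

    The Laplacian of a power comes from iterating the product rule
    ([qpow_d1], [qpow_d2]) and summing over the basis directions: the identity
    [sum_e e * p * e = - 2 * qconj p] ([sum_basis_sandwich]) turns the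
    noncommutative sums into sums of products of powers of [q] and [qconj q]
    ([sum_basis_qpow_d2_fueter_Q]).

    Differentiating termwise is legitimate because [Omega] is open: near a point
    [q] of [Omega] there is a point of [Omega] of larger modulus, where the
    terms of the series are bounded, so that around [q] the coefficients are
    dominated by a geometric sequence with room to spare.  Bounds of Cauchy type
    on the derivatives of the powers, and on their quadratic Taylor remainders,
    then make every series involved converge ([termwise_is_derive],
    [fueter_map_expands]).

    Norms and the conditions [f(0) = f'(0) = 0] refer to the coefficients of a
    function, so these have to be unique.  Both [q ^+ k] and [fueter_Q k] equal
    [x ^+ k] at a real [x], and [Omega] contains a real interval, possibly far
    from [0]; uniqueness is the identity theorem for real power series
    ([power_series_identity], [coefs_unique]), proved by moving the vanishing of
    the Taylor coefficients to [0] in steps of constant length.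

    Surjectivity is the only place where the [fueter_Q k] have to be bounded
    from below: a series in the [fueter_Q k] converging at a non-real point [q]
    must force the power series to converge there too.  With
    [S = \sum_j (k - j).+1 *: (q ^+ (k - j) * qconj q ^+ j)], a multiple of
    [fueter_Q k q], telescoping shows that [(q - qconj q) ^+ 2 * S] is
    [k.+2 *: (q ^+ k.+1 * (q - qconj q))] up to a bounded multiple of
    [qabs q ^+ k.+2]; hence the modulus of [fueter_Q k q] is at least a constant
    multiple of [qabs q ^+ k.+2 / (k.+1 * k.+2)] for large [k]
    ([fueter_Q_lower]). *)

(** * The quaternionic modulus *)

Section QuaternionModulus.
Variable R : realType.
Implicit Types (p q : quat R) (x : R) (k : nat).

Lemma qabs_ge0 q : 0 <= qabs q.
Proof. exact: sqrtr_ge0. Qed.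

Lemma qabs_sqr q :
  qabs q ^+ 2 = qcoord q 0 ^+ 2 + qcoord q 1 ^+ 2 + qcoord q 2 ^+ 2
                + qcoord q 3 ^+ 2.
Proof.
rewrite /qabs sqr_sqrtr; last by apply: sumr_ge0 => i _; exact: sqr_ge0.
by rewrite !big_ord_recl big_ord0 /= addr0 !addrA.
Qed.

Lemma qmulE p q : p * q = qmul p q. Proof. by []. Qed.

Lemma qoneE : 1 = mkquat 1 0 0 0 :> quat R. Proof. by []. Qed.

Lemma qcoordN q n : qcoord (- q) n = - qcoord q n.
Proof. by rewrite /qcoord mxE. Qed.

Lemma qcoord0 n : qcoord (0 : quat R) n = 0.
Proof. by rewrite /qcoord mxE. Qed.

Lemma qabs_eq p x : 0 <= x -> qabs p ^+ 2 = x ^+ 2 -> qabs p = x.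
Proof.
by move=> x0 /eqP; rewrite eqrXn2 ?qabs_ge0// => /eqP.
Qed.

Lemma qabsM p q : qabs (p * q) = qabs p * qabs q.
Proof.
apply: qabs_eq; first by rewrite mulr_ge0 ?qabs_ge0.
by rewrite exprMn !qabs_sqr qmulE !qcoord_mk //=; ring.
Qed.

Lemma qabs1 : qabs (1 : quat R) = 1.
Proof.
by apply: qabs_eq => //; rewrite qabs_sqr qoneE !qcoord_mk //=; ring.
Qed.

Lemma qabs0 : qabs (0 : quat R) = 0.
Proof.
by apply: qabs_eq => //; rewrite qabs_sqr !qcoord0; ring.
Qed.

Lemma qabsX q k : qabs (q ^+ k) = qabs q ^+ k.
Proof.
by elim: k => [|k IH]; rewrite ?expr0 ?qabs1// !exprS qabsM IH.
Qed.

Lemma qabsZ x q : qabs (x *: q) = `|x| * qabs q.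
Proof.
apply: qabs_eq; first by rewrite mulr_ge0 ?qabs_ge0.
by rewrite exprMn real_normK ?num_real// !qabs_sqr !qcoordZ; ring.
Qed.

Lemma qabsN q : qabs (- q) = qabs q.
Proof.
by apply: qabs_eq; rewrite ?qabs_ge0// !qabs_sqr !qcoordN; ring.
Qed.

Lemma qabs_conj q : qabs (qconj q) = qabs q.
Proof.
by apply: qabs_eq; rewrite ?qabs_ge0// !qabs_sqr !qcoord_mk //=; ring.
Qed.

(** The triangle inequality reduces, via the multiplicativity of the modulus,
    to the fact that the real part of [p * qconj q] is at most its modulus. *)
Lemma qabsD p q : qabs (p + q) <= qabs p + qabs q.
Proof.
rewrite -(@ler_pXn2r _ 2) ?nnegrE ?addr_ge0 ?qabs_ge0//.
have re_le : qcoord (p * qconj q) 0 <= qabs (p * qconj q).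
  apply: le_trans (ler_norm _) _.
  rewrite -(@ler_pXn2r _ 2) ?nnegrE ?qabs_ge0// real_normK ?num_real//.
  by rewrite qabs_sqr -!addrA lerDl !addr_ge0 ?sqr_ge0.
rewrite qabsM qabs_conj qmulE !qcoord_mk //= in re_le.
rewrite sqrrD !qabs_sqr !qcoordD.
by move: (qabs p * qabs q) re_le => z; nra.
Qed.

(** The topology of [quat R] is that of the sup norm, to which the
    multiplicative modulus has to be compared. *)
Lemma norm_le_qabs q : `|q| <= qabs q.
Proof.
rewrite [`|q|]mx_normrE; apply: bigmax_le => [|[i j] _] /=.
  exact: qabs_ge0.
rewrite ord1 -(@ler_pXn2r _ 2) ?nnegrE ?qabs_ge0// real_normK ?num_real//.
rewrite /qabs sqr_sqrtr; last by apply: sumr_ge0 => ? _; exact: sqr_ge0.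
rewrite (bigD1 j)//= /qcoord inord_val lerDl.
by apply: sumr_ge0 => ? _; exact: sqr_ge0.
Qed.

Lemma qabs_eq0 q : qabs q = 0 -> q = 0.
Proof.
by move=> q0; apply/eqP; rewrite -normr_le0 (le_trans (norm_le_qabs q))// q0.
Qed.

Lemma qabs_le_norm q : qabs q <= 2 * `|q|.
Proof.
have coord_le n : qcoord q n ^+ 2 <= `|q| ^+ 2.
  rewrite -[leLHS]real_normK ?num_real// ler_pXn2r ?nnegrE//.
  rewrite [`|q|]mx_normrE.
  by exact: (le_bigmax _ (fun ij => `|q ij.1 ij.2|) (ord0, inord n)).
rewrite -(@ler_pXn2r _ 2) ?nnegrE ?qabs_ge0// ?mulr_ge0// qabs_sqr exprMn.
by have := (coord_le 0%N, coord_le 1%N, coord_le 2%N, coord_le 3%N); case=> [[[]]]; lra.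
Qed.

Lemma norm_mul_le p q : `|p * q| <= qabs p * qabs q.
Proof. by rewrite -qabsM norm_le_qabs. Qed.

Lemma qconjM p q : qconj (p * q) = qconj q * qconj p.
Proof. by apply: quatP; rewrite !qmulE !qcoord_mk //=; ring. Qed.

Lemma qconjX q k : qconj (q ^+ k) = qconj q ^+ k.
Proof.
elim: k => [|k IH]; last by rewrite exprSr qconjM IH exprS.
by apply: quatP; rewrite !expr0 ?qoneE !qcoord_mk //= oppr0.
Qed.

Lemma comm_qconj q : q * qconj q = qconj q * q.
Proof. by apply: quatP; rewrite !qmulE !qcoord_mk //=; ring. Qed.

Lemma comm_qconjX q k : q * qconj q ^+ k = qconj q ^+ k * q.
Proof. exact/commrX/comm_qconj. Qed.

Lemma qconj_real x : qconj (x%:A : quat R) = x%:A.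
Proof.
apply: quatP; rewrite ?qcoord_mk //= !qcoordZ qoneE !qcoord_mk //=;
by rewrite mulr0 oppr0.
Qed.

Lemma qabs_real x : qabs (x%:A : quat R) = `|x|.
Proof. by rewrite qabsZ qabs1 mulr1. Qed.

Lemma realX x k : (x%:A : quat R) ^+ k = (x ^+ k)%:A.
Proof. by rewrite exprZn expr1n. Qed.

Lemma qabs_basis i : qabs (qbasis R i) = 1.
Proof.
apply: qabs_eq => //; rewrite /qabs sqr_sqrtr; last first.
  by apply: sumr_ge0 => ? _; exact: sqr_ge0.
rewrite (bigD1 i)//= /qcoord inord_val mxE !eqxx big1 ?addr0// => j /negPf ji.
by rewrite inord_val mxE ji andbF expr0n.
Qed.

(** This is the source of conjugation in the Fueter theorem: an imaginary unit
    anticommutes with the two other ones and commutes with itself. *)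
Lemma sum_basis_sandwich p :
  \sum_(i < 4) qbasis R i * p * qbasis R i = (- 2) *: qconj p.
Proof.
have E (i : 'I_4) : qbasis R i = mkquat (i == 0 :> nat)%:R (i == 1 :> nat)%:R
    (i == 2 :> nat)%:R (i == 3 :> nat)%:R.
  apply: quatP; rewrite qcoord_mk //= /qcoord mxE eqxx -val_eqE /= inordK //;
  by rewrite eq_sym.
have sandwich0 : mkquat 1 0 0 0 * p * mkquat 1 0 0 0 = p.
  by rewrite -qoneE mulr1 mul1r.
have sandwich1 : mkquat 0 1 0 0 * p * mkquat 0 1 0 0 =
    mkquat (- qcoord p 0) (- qcoord p 1) (qcoord p 2) (qcoord p 3).
  by apply: quatP; rewrite !(qmulE, qcoord_mk) //=; ring.
have sandwich2 : mkquat 0 0 1 0 * p * mkquat 0 0 1 0 =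
    mkquat (- qcoord p 0) (qcoord p 1) (- qcoord p 2) (qcoord p 3).
  by apply: quatP; rewrite !(qmulE, qcoord_mk) //=; ring.
have sandwich3 : mkquat 0 0 0 1 * p * mkquat 0 0 0 1 =
    mkquat (- qcoord p 0) (qcoord p 1) (qcoord p 2) (- qcoord p 3).
  by apply: quatP; rewrite !(qmulE, qcoord_mk) //=; ring.
rewrite !big_ord_recl big_ord0 addr0 !E /=.
rewrite sandwich0 sandwich1 sandwich2 sandwich3.
by apply: quatP; rewrite !(qcoordD, qcoordZ, qcoord_mk) //=; ring.
Qed.

End QuaternionModulus.

(** * Power series and the identity theorem *)

Section SeriesEstimates.
Variables (R : realType) (V : completeNormedModType R).
Implicit Types (u : nat -> V) (l : V) (M r : R).

Lemma geometric_dominated_series u M r : 0 <= r -> r < 1 ->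
    (forall k, `|u k| <= M * r ^+ k) ->
  cvgn (series u) /\ forall n, `|series u n| <= M / (1 - r).
Proof.
move=> r0 r1 uM.
have M0 : 0 <= M by have := uM 0%N; rewrite expr0 mulr1; exact: le_trans.
split.
  apply: normed_cvg; apply: (@series_le_cvg _ _ (geometric M r)) => //.
  - by move=> n; rewrite /=.
  - by move=> n; rewrite /geometric/= mulr_ge0// exprn_ge0.
  - by apply: is_cvg_geometric_series; rewrite ger0_norm.
move=> n; rewrite /series/= (le_trans (ler_norm_sum _ _ _))//.
apply: (@le_trans _ _ (series (geometric M r) n)).
  by rewrite /series/=; apply: ler_sum => k _; exact: uM.
rewrite geometric_seriesE ?lt_eqF//= ler_pM2r ?invr_gt0 ?subr_gt0//.
by rewrite ler_piMr// gerBl exprn_ge0.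
Qed.

Lemma norm_lim_le u l M :
  u @ \oo --> l -> (forall n, `|u n| <= M) -> `|l| <= M.
Proof.
move=> ul uM; have nul : `|u n| @[n --> \oo] --> `|l| by exact: cvg_norm.
rewrite -(cvg_lim _ nul)//; apply: limr_le; first by apply/cvg_ex; exists `|l|.
by near=> n; exact: uM.
Unshelve. all: by end_near. Qed.

End SeriesEstimates.

Lemma is_derive_quadratic (R : realType) (V W : normedModType R) (f : V -> W)
    (x v : V) (l : W) (M d : R) : 0 < d ->
  (forall h : R, `|h| < d -> `|f (h *: v + x) - f x - h *: l| <= M * h ^+ 2) ->
  is_derive x v f l.
Proof.
move=> d0 fM.
suff fl : h^-1 *: ((f \o shift x) (h *: v) - f x) @[h --> 0^'] --> l.
  by split; [apply/cvg_ex; exists l | exact: cvg_lim fl].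
apply/cvgrPdist_le => e e0.
have M1 : 0 < `|M| + 1 by rewrite ltr_wpDl.
near=> h.
have h0 : h != 0 by near: h; exact: nbhs_dnbhs_neq.
have hd : `|h| < d by near: h; apply: dnbhs0_lt.
have he : `|h| <= e / (`|M| + 1) by near: h; apply: dnbhs0_le; rewrite divr_gt0.
rewrite distrC /= -[X in _ - X]scale1r -(mulVf h0) -scalerA -scalerBr normrZ.
rewrite normfV ler_pdivrMl ?normr_gt0//.
apply: le_trans (fM h hd) _.
rewrite -[h ^+ 2]real_normK ?num_real// expr2 mulrCA ler_pM2l ?normr_gt0//.
apply: (@le_trans _ _ ((`|M| + 1) * `|h|)).
  by apply: ler_wpM2r => //; rewrite (le_trans (ler_norm _))// lerDl.
by rewrite mulrC -ler_pdivlMr.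
Unshelve. all: by end_near. Qed.

Section IdentityTheorem.
Variables (R : realType) (V : completeNormedModType R).
Implicit Types (a : nat -> V) (s m x h : R) (n N k : nat).

(** Abel's condition: it holds with [s] the modulus of any point of convergence,
    and gives absolute convergence strictly inside the disc of radius [s]. *)
Definition coef_bounded s a := exists M : R, forall k, `|a k| * s ^+ k <= M.

Lemma coef_bounded_series s a (w : nat -> R) (K r : R) :
    coef_bounded s a -> 0 <= r -> r < s -> 0 <= K ->
    (forall k, `|w k| <= K * r ^+ k) -> cvgn (series (fun k => w k *: a k)).
Proof.
move=> [M aM] r0 rs K0 wK; have s0 : 0 < s by exact: le_lt_trans rs.
apply: (proj1 (@geometric_dominated_series _ _ _ (K * M) (r / s) _ _ _)).
- by rewrite divr_ge0// ltW.
- by rewrite ltr_pdivrMr// mul1r.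
move=> k; rewrite normrZ expr_div_n.
apply: (@le_trans _ _ (K * r ^+ k * `|a k|)); first exact: ler_wpM2r.
rewrite -!mulrA; apply: ler_wpM2l => //; rewrite [leRHS]mulrCA.
apply: ler_wpM2l; first exact: exprn_ge0.
by rewrite ler_pdivlMr ?exprn_gt0.
Qed.

Definition taylor_coef a x n : V :=
  limn (series (fun k => ('C(k, n)%:R * x ^+ (k - n)) *: a k)).

(** The left-hand side is, up to the factor [m ^+ n], one term of the binomial
    expansion of [(`|x| + m) ^+ k]. *)
Lemma binom_le k n x m : 0 < m ->
  `|'C(k, n)%:R * x ^+ (k - n)| <= m ^- n * (`|x| + m) ^+ k.
Proof.
move=> m0; rewrite normrM normr_nat normrX ler_pdivlMl ?exprn_gt0//.
have [kn|nk] := ltnP k n.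
  by rewrite bin_small// mul0r mulr0 exprn_ge0// addr_ge0// ltW.
rewrite exprDn (bigD1 (Ordinal (nk : (n < k.+1)%N)))//=.
have -> : m ^+ n * ('C(k, n)%:R * `|x| ^+ (k - n)) =
    `|x| ^+ (k - n) * m ^+ n *+ 'C(k, n) by rewrite -mulr_natl; ring.
rewrite lerDl; apply: sumr_ge0 => i _.
by rewrite mulrn_wge0// mulr_ge0// exprn_ge0// ltW.
Qed.

(** The remainder consists of the binomial terms of degree at least [N] in [h];
    in each of them [N] factors [`|h| / m] are extracted and the others, at most
    [1], are dropped. *)
Lemma taylor_monomial_rem k N x h m : 0 < m -> `|h| <= m ->
  `|(x + h) ^+ k - \sum_(n < N) h ^+ n * ('C(k, n)%:R * x ^+ (k - n))|
  <= (`|h| / m) ^+ N * (`|x| + m) ^+ k.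
Proof.
move=> m0 hm; pose g n := h ^+ n * ('C(k, n)%:R * x ^+ (k - n)).
have hm1 : 0 <= `|h| / m <= 1.
  by rewrite divr_ge0 ?(ltW m0)//= ler_pdivrMr// mul1r.
have -> : (x + h) ^+ k = \sum_(n < k.+1) g n.
  rewrite exprDn; apply: eq_bigr => i _.
  by rewrite /g -mulr_natl; ring.
rewrite -(big_mkord xpredT g) -(big_mkord xpredT g).
have [kN|Nk] := leqP k.+1 N.
  rewrite [X in _ - X](big_cat_nat (leq0n _) kN)//= opprD addrA subrr.
  rewrite sub0r normrN big_nat_cond.
  rewrite big1 => [|i /andP[/andP[ki _] _]]; last first.
    by rewrite /g bin_small// mul0r mulr0.
  rewrite normr0 mulr_ge0// exprn_ge0//; first by case/andP: hm1.
  by rewrite addr_ge0// ltW.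
rewrite [X in X - _](big_cat_nat (leq0n _) (ltnW Nk))//= addrAC subrr add0r.
rewrite (le_trans (ler_norm_sum _ _ _))// exprDn mulr_sumr.
rewrite -(big_mkord xpredT (fun i => (`|h| / m) ^+ N *
  (`|x| ^+ (k - i) * m ^+ i *+ 'C(k, i)))) [leRHS](big_cat_nat (leq0n _) (ltnW Nk))//=.
rewrite -[leLHS]add0r lerD//.
  rewrite sumr_ge0// => i _.
  rewrite mulr_ge0 ?exprn_ge0//; first by case/andP: hm1.
  by rewrite mulrn_wge0// mulr_ge0// exprn_ge0// ltW.
rewrite big_nat_cond [leRHS]big_nat_cond.
apply: ler_sum => i /andP[/andP[Ni _] _].
rewrite /g !normrM !normrX normr_nat -[_ *+ _ in leRHS]mulr_natl.
have -> : `|h| ^+ i = (`|h| / m) ^+ i * m ^+ i.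
  by rewrite expr_div_n divfK// expf_neq0// gt_eqF.
have -> : (`|h| / m) ^+ i * m ^+ i * ('C(k, i)%:R * `|x| ^+ (k - i)) =
    (`|h| / m) ^+ i * ('C(k, i)%:R * (`|x| ^+ (k - i) * m ^+ i)) by ring.
apply: ler_wpM2r; last by rewrite ler_wiXn2l//; case/andP: hm1.
by rewrite !mulr_ge0// exprn_ge0// ltW.
Qed.

(** Taylor's formula at [x], with a remainder whose constant [K] depends neither
    on the order [N] nor on the increment [h]: this uniformity in [N] lets the
    order tend to infinity for a fixed increment. *)
Lemma taylor_bound s a x m : coef_bounded s a -> 0 < m -> `|x| + m < s ->
  exists2 K, 0 <= K & forall N h l, `|h| <= m ->
    series (fun k => (x + h) ^+ k *: a k) @ \oo --> l ->
    `|l - \sum_(n < N) h ^+ n *: taylor_coef a x n| <= K * (`|h| / m) ^+ N.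
Proof.
move=> abd m0 xms; have [M aM] := abd.
have xm0 : 0 <= `|x| + m by rewrite addr_ge0// ltW.
have s0 : 0 < s by exact: le_lt_trans xms.
have M0 : 0 <= M.
  by apply: le_trans (aM 0%N); rewrite mulr_ge0// exprn_ge0// ltW.
pose r := (`|x| + m) / s.
have r0 : 0 <= r by rewrite divr_ge0// ltW.
have r1 : r < 1 by rewrite ltr_pdivrMr// mul1r.
exists (M / (1 - r)); first by rewrite divr_ge0// subr_ge0 ltW.
move=> N h l hm hl.
have hm0 : 0 <= `|h| / m by rewrite divr_ge0// ltW.
pose rem k := ((x + h) ^+ k
  - \sum_(n < N) h ^+ n * ('C(k, n)%:R * x ^+ (k - n))) *: a k.
have rem_le k : `|rem k| <= M * (`|h| / m) ^+ N * r ^+ k.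
  rewrite normrZ; apply: (@le_trans _ _
    ((`|h| / m) ^+ N * (`|x| + m) ^+ k * `|a k|)).
    by apply: ler_wpM2r => //; exact: taylor_monomial_rem.
  rewrite [M * _]mulrC -!mulrA; apply: ler_wpM2l; first exact: exprn_ge0.
  rewrite /r expr_div_n mulrCA; apply: ler_wpM2l; first exact: exprn_ge0.
  by rewrite ler_pdivlMr ?exprn_gt0.
have remE : series rem = fun n => series (fun k => (x + h) ^+ k *: a k) n
    - \sum_(i < N) h ^+ i *: series (fun k =>
        ('C(k, i)%:R * x ^+ (k - i)) *: a k) n.
  apply/funext => n; rewrite /series/=.
  under [X in _ - X]eq_bigr do rewrite scaler_sumr.
  rewrite exchange_big/= -sumrB; apply: eq_bigr => k _.
  rewrite /rem scalerBl scaler_suml; congr (_ - _).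
  by apply: eq_bigr => i _; rewrite scalerA.
have : series rem @ \oo --> l - \sum_(n < N) h ^+ n *: taylor_coef a x n.
  rewrite remE; apply: cvgB => //.
  apply: cvg_big => [|i _]; first exact: add_continuous.
  apply: cvgZ; first exact: cvg_cst.
  apply: (coef_bounded_series abd xm0 xms _ (fun k => binom_le k i x m0)).
  by rewrite invr_ge0 exprn_ge0// ltW.
move=> /norm_lim_le; apply => n; rewrite mulrAC.
exact: (proj2 (geometric_dominated_series r0 r1 rem_le)).
Qed.

Definition locally_zero a x :=
  \forall y \near x, series (fun k => y ^+ k *: a k) @ \oo --> (0 : V).

Lemma taylor_coef_locally_zero s a x : coef_bounded s a -> `|x| < s ->
  locally_zero a x -> forall n, taylor_coef a x n = 0.
Proof.
move=> abd xs ax0; pose m := (s - `|x|) / 2.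
have m0 : 0 < m by rewrite divr_gt0// subr_gt0.
have xms : `|x| + m < s.
  by rewrite /m; lra.
have [K K0 aK] := taylor_bound abd m0 xms.
have [d /= d0 ad0] := ax0.
elim/ltn_ind => n IH.
(* The partial Taylor sum of order n.+1 reduces to its last term, so the
   remainder estimate bounds the coefficient by a multiple of the increment. *)
have coef_le h : 0 < h -> h < d -> h <= m ->
    `|taylor_coef a x n| <= K / m ^+ n.+1 * h.
  move=> h0 hd hm; have hn : `|h| = h by exact: gtr0_norm.
  have ser0 : series (fun k => (x + h) ^+ k *: a k) @ \oo --> (0 : V).
    by apply: ad0; rewrite /= opprD addrA subrr sub0r normrN hn.
  have := aK n.+1 h 0; rewrite hn => /(_ hm ser0).
  rewrite big_ord_recr/= big1 => [|i _]; last by rewrite IH// scaler0.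
  rewrite !add0r normrN normrZ normrX hn expr_div_n.
  have -> : K * (h ^+ n.+1 / m ^+ n.+1) = h ^+ n * (K / m ^+ n.+1 * h).
    by rewrite [h ^+ n.+1]exprS; ring.
  by rewrite ler_pM2l// exprn_gt0.
apply/eqP; rewrite -normr_le0; apply/ler_addgt0Pr => e e0; rewrite add0r.
set C := K / m ^+ n.+1 in coef_le.
have C0 : 0 <= C by rewrite divr_ge0// exprn_ge0// ltW.
pose h := Num.min (Num.min (d / 2) m) (e / (C + 1)).
have h0 : 0 < h by rewrite !lt_min m0 !divr_gt0// ltr_wpDl.
apply: le_trans (coef_le h h0 _ _) _.
- by rewrite !gt_min; apply/orP; left; apply/orP; left; lra.
- by rewrite !ge_min lexx orbT.
apply: (@le_trans _ _ ((C + 1) * h)); first by rewrite ler_pM2r// lerDl.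
by rewrite mulrC -ler_pdivlMr ?ltr_wpDl// !ge_min lexx orbT.
Qed.

(** Without Taylor coefficients only the remainder is left, and it tends to [0]
    as the order grows. *)
Lemma locally_zero_propagates s a x m h : coef_bounded s a ->
  0 < m -> `|x| + m < s -> (forall n, taylor_coef a x n = 0) ->
  `|h| < m -> locally_zero a (x + h).
Proof.
move=> abd m0 xms ax0 hm; have [K K0 aK] := taylor_bound abd m0 xms.
exists (m - `|h|); first by rewrite /= subr_gt0.
move=> y /= yh; pose k := y - x.
have km : `|k| < m.
  have -> : k = h - (x + h - y) by rewrite /k; ring.
  by rewrite (le_lt_trans (ler_normB _ _))//; lra.
have -> : y = x + k by rewrite /k; ring.
have : cvgn (series (fun j => (x + k) ^+ j *: a j)).
  apply: (@coef_bounded_series s a _ 1 (`|x| + m)) => // [|j].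
    by rewrite addr_ge0// ltW.
  rewrite mul1r normrX lerXn2r ?nnegrE ?addr_ge0 ?(ltW m0)//.
  by rewrite (le_trans (ler_normD _ _))// lerD2l ltW.
set f := series _ => fl.
suff l0 : limn f = 0 by rewrite -l0.
have l_le N : `|limn f| <= K * (`|k| / m) ^+ N.
  have := aK N k _ (ltW km) fl.
  by rewrite big1 ?subr0// => i _; rewrite ax0 scaler0.
have geo0 : K * (`|k| / m) ^+ N @[N --> \oo] --> 0.
  rewrite -[X in _ --> X](mulr0 K); apply: cvgM; first exact: cvg_cst.
  apply: cvg_expr.
  by rewrite normrM normr_id normfV (gtr0_norm m0) ltr_pdivrMr// mul1r.
apply/eqP; rewrite -normr_le0 -(cvg_lim _ geo0)//.
apply: limr_ge; first by apply/cvg_ex; exists 0.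
by near=> N; exact: l_le.
Unshelve. all: by end_near. Qed.

(** Only the term of index [n] survives, since ['C(k, n)] vanishes for [k < n]
    and [0 ^+ (k - n)] for [k > n]. *)
Lemma taylor_coef0 a n : taylor_coef a 0 n = a n.
Proof.
apply: cvg_lim => //; apply: cvg_near_cst; exists n.+1 => // N /= nN.
rewrite /series/= big_mkord (bigD1 (Ordinal nN))//= binn subnn expr0 mulr1.
rewrite scale1r big1 ?addr0// => i; rewrite -val_eqE/= => ni.
have [lt_in|gt_in|] := ltngtP i n; last by move=> e; rewrite e eqxx in ni.
  by rewrite bin_small// mul0r scale0r.
by rewrite expr0n subn_eq0 leqNgt gt_in/= mulr0 scale0r.
Qed.

(** The zero set is propagated from [x] to [0] in finitely many steps of one
    fixed length: every point between [0] and [x] has modulus at most [`|x|],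
    so the same Taylor disc radius is available at each of them. *)
Lemma power_series_identity s a x : coef_bounded s a -> `|x| < s ->
  locally_zero a x -> forall n, a n = 0.
Proof.
move=> abd xs ax0.
suff a00 : locally_zero a 0.
  move=> n; rewrite -taylor_coef0.
  by apply: (taylor_coef_locally_zero abd) => //; rewrite normr0 (le_lt_trans _ xs).
pose m := (s - `|x|) / 2.
have m0 : 0 < m by rewrite divr_gt0// subr_gt0.
have xms : `|x| + m < s by rewrite /m; lra.
pose N := (Num.truncn (`|x| / m)).+1.
have N0 : 0 < N%:R :> R by rewrite ltr0n.
have step : `|x| / N%:R < m.
  rewrite ltr_pdivrMr// mulrC -ltr_pdivrMr//.
  by have := truncnS_gt (`|x| / m).
have walk i : (i <= N)%N -> locally_zero a (x * (1 - i%:R / N%:R)).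
  elim: i => [|i IH] iN; first by rewrite mul0r subr0 mulr1.
  have {IH} := IH (ltnW iN); set y := x * _ => ay.
  have yx : `|y| <= `|x|.
    rewrite normrM ler_piMr// ger0_norm ?gerBl ?divr_ge0//.
    by rewrite subr_ge0 ler_pdivrMr// mul1r ler_nat ltnW.
  have -> : x * (1 - i.+1%:R / N%:R) = y + - (x / N%:R).
    by rewrite /y -natr1; field; rewrite gt_eqF.
  apply: (@locally_zero_propagates s a y m) => //.
  - by apply: le_lt_trans xms; rewrite lerD2r.
  - by apply: (taylor_coef_locally_zero abd) => //; exact: le_lt_trans xs.
  - by rewrite normrN normrM normfV (gtr0_norm N0).
by have := walk N (leqnn N); rewrite divff ?gt_eqF// subrr mulr0.
Qed.

End IdentityTheorem.

(** * Sums of conjugate powers and the polynomials Q_k *)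

Section ConjugatePowerSums.
Variable R : realType.
Implicit Types (p q : quat R) (k j : nat) (x : R).

Definition conj_sum k q : quat R := \sum_(j < k.+1) q ^+ (k - j) * qconj q ^+ j.

Definition conj_wsum k q : quat R :=
  \sum_(j < k.+1) (k - j).+1%:R *: (q ^+ (k - j) * qconj q ^+ j).

Lemma conj_sum0 q : conj_sum 0 q = 1.
Proof. by rewrite /conj_sum big_ord1 mulr1. Qed.

Lemma conj_wsum0 q : conj_wsum 0 q = 1.
Proof. by rewrite /conj_wsum big_ord1 mulr1 scale1r. Qed.

Lemma conj_sumS k q : conj_sum k.+1 q = q * conj_sum k q + qconj q ^+ k.+1.
Proof.
rewrite /conj_sum big_ord_recr/= subnn expr0 mul1r mulr_sumr; congr (_ + _).
by apply: eq_bigr => j _; rewrite subSn ?leq_ord// exprS mulrA.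
Qed.

Lemma comm_conj_sum k q : q * conj_sum k q = conj_sum k q * q.
Proof.
rewrite /conj_sum mulr_sumr mulr_suml; apply: eq_bigr => j _.
by rewrite -mulrA -comm_qconjX !mulrA -exprSr exprS.
Qed.

Lemma conj_wsumS k q : conj_wsum k.+1 q = q * conj_wsum k q + conj_sum k.+1 q.
Proof.
rewrite /conj_wsum /conj_sum big_ord_recr/= subnn scale1r.
rewrite [X in _ = _ + X]big_ord_recr/= subnn addrA mulr_sumr -big_split/=.
congr (_ + _); apply: eq_bigr => j _.
rewrite subSn ?leq_ord// -scalerAr mulrA -exprS.
by rewrite -[X in _ + X]scale1r -scalerDl natr1.
Qed.

Lemma fueter_QE k q :
  fueter_Q k q = (2 / (k.+1%:R * k.+2%:R)) *: conj_wsum k q.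
Proof.
rewrite /fueter_Q /conj_wsum scaler_sumr; apply: eq_bigr => j _.
by rewrite scalerA /fueter_T; congr (_ *: _); ring.
Qed.

(** Geometric sum for the commuting elements [q] and [qconj q]. *)
Lemma mul_Im_conj_sum k q :
  (q - qconj q) * conj_sum k q = q ^+ k.+1 - qconj q ^+ k.+1.
Proof.
elim: k => [|k IH]; first by rewrite conj_sum0 mulr1.
rewrite conj_sumS mulrDr mulrA [(q - _) * q]mulrBl -comm_qconj -mulrBr -mulrA IH.
by rewrite mulrBr mulrBl -!exprS addrA subrK.
Qed.

Lemma mul_Im_conj_wsum k q :
  (q - qconj q) * conj_wsum k q = k.+2%:R *: q ^+ k.+1 - conj_sum k.+1 q.
Proof.
elim: k => [|k IH].
  rewrite conj_wsum0 conj_sumS conj_sum0 !mulr1 expr1 scaler_nat mulr2n.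
  by rewrite opprD addrA addrK.
rewrite conj_wsumS mulrDr mulrA [(q - _) * q]mulrBl -comm_qconj -mulrBr -mulrA IH.
rewrite mul_Im_conj_sum [conj_sum k.+2 q]conj_sumS mulrBr -scalerAr -exprS.
move: (q ^+ k.+2) (qconj q ^+ k.+2) (q * conj_sum k.+1 q) => A B C.
by apply/rowP => i; rewrite !mxE; ring.
Qed.

Lemma fueter_Q_selfconj k q : qconj q = q -> fueter_Q k q = q ^+ k.
Proof.
move=> qR.
have conj_sumE n : conj_sum n q = n.+1%:R *: q ^+ n.
  elim: n => [|n IH]; first by rewrite conj_sum0 scale1r.
  rewrite conj_sumS IH qR -scalerAr -exprS.
  by rewrite addrC -[X in X + _]scale1r -scalerDl nat1r.
suff wsumE : conj_wsum k q = (k.+1%:R * k.+2%:R / 2) *: q ^+ k.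
  rewrite fueter_QE wsumE scalerA -[RHS]scale1r; congr (_ *: _).
  have : k.+1%:R * k.+2%:R != 0 :> R by rewrite mulf_neq0 ?pnatr_eq0.
  by move: (k.+1%:R * _) => N N0; field.
elim: k => [|k IH].
  by rewrite conj_wsum0 expr0 -[LHS]scale1r; congr (_ *: _); field.
rewrite conj_wsumS IH conj_sumE -scalerAr -exprS -scalerDl.
by congr (_ *: _); field.
Qed.

Lemma fueter_Q_real k x : fueter_Q k (x%:A : quat R) = (x ^+ k)%:A.
Proof. by rewrite fueter_Q_selfconj ?qconj_real// realX. Qed.

(** Multiplying twice by the imaginary part [q - qconj q] turns [conj_wsum] into
    [k.+2%:R *: (q ^+ k.+1 * (q - qconj q))] up to a term of modulus at most
    [2 * qabs q ^+ k.+2], so off the real line the linear growth of the factor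
    [k.+2] eventually beats the error. *)
Lemma fueter_Q_lower q : exists2 K : R, 0 <= K &
  \forall k \near \oo,
    qabs q ^+ k.+2 <= K * (k.+1%:R * k.+2%:R) * qabs (fueter_Q k q).
Proof.
have r0 := qabs_ge0 q; set r := qabs q in r0 *.
have [qR|qNR] := eqVneq (qconj q) q.
  exists (r ^+ 2); first exact: exprn_ge0.
  near=> k; rewrite fueter_Q_selfconj// qabsX -/r -addn2 exprD.
  rewrite mulrAC [r ^+ k * _]mulrC ler_peMr// ?mulr_ge0 ?exprn_ge0//.
  by rewrite -natrM ler1n muln_gt0 addn2.
have d0 : 0 < qabs (q - qconj q).
  rewrite lt_neqAle qabs_ge0 andbT eq_sym; apply: contraNneq qNR => /qabs_eq0.
  by move/subr0_eq => <-.
set d := qabs _ in d0.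
exists (d ^+ 2 / 4); first by rewrite divr_ge0// exprn_ge0// ltW.
near=> k.
have kd : 4 * r / d <= k%:R by near: k; exact: nbhs_infty_ger.
have kd' : 4 * r <= k.+2%:R * d.
  rewrite -ler_pdivrMr// (le_trans kd)// ler_nat.
  by rewrite -addn2 leq_addr.
have sum_le : d * qabs (conj_sum k.+1 q) <= 2 * r ^+ k.+2.
  rewrite -qabsM mul_Im_conj_sum (le_trans (qabsD _ _))//.
  by rewrite qabsN !qabsX qabs_conj -/r mulr_natl mulr2n.
have wsum_ge : k.+2%:R * r ^+ k.+1 <=
    d * qabs (conj_wsum k q) + qabs (conj_sum k.+1 q).
  rewrite -qabsM mul_Im_conj_wsum; apply: le_trans (qabsD _ _).
  by rewrite subrK qabsZ ger0_norm// qabsX.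
have {wsum_ge} wsum_ge : k.+2%:R * d * r ^+ k.+1 <=
    d ^+ 2 * qabs (conj_wsum k q) + 2 * r ^+ k.+2.
  apply: le_trans (_ : d * (d * qabs (conj_wsum k q)
    + qabs (conj_sum k.+1 q)) <= _); last by rewrite mulrDr mulrA lerD2l.
  by rewrite mulrAC [leLHS]mulrC ler_pM2l.
have {}wsum_ge : 2 * r ^+ k.+2 <= d ^+ 2 * qabs (conj_wsum k q).
  rewrite -(lerD2r (2 * r ^+ k.+2)); apply: le_trans wsum_ge.
  have -> : 2 * r ^+ k.+2 + 2 * r ^+ k.+2 = 4 * r * r ^+ k.+1.
    by rewrite [r ^+ k.+2]exprS; ring.
  by rewrite ler_wpM2r// exprn_ge0.
rewrite fueter_QE qabsZ ger0_norm ?divr_ge0 ?mulr_ge0//.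
move: wsum_ge; set S := qabs (conj_wsum k q).
have -> : d ^+ 2 / 4 * (k.+1%:R * k.+2%:R) * (2 / (k.+1%:R * k.+2%:R) * S)
    = d ^+ 2 * S / 2.
  have : k.+1%:R * k.+2%:R != 0 :> R by rewrite mulf_neq0 ?pnatr_eq0.
  by move: (k.+1%:R * _) => N N0; field.
by rewrite ler_pdivlMr// mulrC.
Unshelve. all: by end_near. Qed.

End ConjugatePowerSums.

(** * Derivatives and Laplacian of the powers *)

Section PowerDerivatives.
Variable R : realType.
Implicit Types (p q e : quat R) (k : nat) (h m rho : R).

(** First and second derivatives of [q ^+ k] in the direction [e].  Splitting off
    the right factor of [q ^+ k.+1] suits the summation over the basis directions;
    the estimates split off the left one, as in [qpow_d1_left]. *)
Fixpoint qpow_d1 e k q : quat R :=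
  if k is n.+1 then qpow_d1 e n q * q + q ^+ n * e else 0.

Fixpoint qpow_d2 e k q : quat R :=
  if k is n.+1 then 2 *: (e * qpow_d1 e n q) + q * qpow_d2 e n q else 0.

Lemma qpow_d1_left e k q : qpow_d1 e k.+1 q = e * q ^+ k + q * qpow_d1 e k q.
Proof.
elim: k => [|k IH]; first by rewrite /= !expr0 mul0r mulr0 mul1r mulr1 addrC.
rewrite -[LHS]/(qpow_d1 e k.+1 q * q + q ^+ k.+1 * e) {1}IH.
rewrite [qpow_d1 e k.+1 q]/= mulrDl mulrDr !mulrA -(mulrA e) -exprSr -exprS.
by rewrite addrA.
Qed.

Definition pow_rem e k q h : quat R :=
  (h *: e + q) ^+ k - q ^+ k - h *: qpow_d1 e k q.

Definition d1_rem e k q h : quat R :=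
  qpow_d1 e k (h *: e + q) - qpow_d1 e k q - h *: qpow_d2 e k q.

Lemma pow_remS e k q h : pow_rem e k.+1 q h =
  (h *: e + q) * pow_rem e k q h + h ^+ 2 *: (e * qpow_d1 e k q).
Proof.
rewrite /pow_rem qpow_d1_left !exprS.
set p := h *: e + q; set P := p ^+ k; set Q := q ^+ k; set D := qpow_d1 e k q.
have pQ : p * Q = h *: (e * Q) + q * Q by rewrite mulrDl scalerAl.
have pD : p * (h *: D) = h ^+ 2 *: (e * D) + h *: (q * D).
  by rewrite mulrDl -scalerAl -!scalerAr scalerA expr2.
rewrite !mulrBr pQ pD scalerDr.
move: (p * P) (e * Q) (q * Q) (e * D) (q * D) => A B C D' E.
by apply/rowP => i; rewrite !mxE; ring.
Qed.

Lemma d1_remS e k q h : d1_rem e k.+1 q h =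
  (h *: e + q) * d1_rem e k q h + e * pow_rem e k q h
  + h ^+ 2 *: (e * qpow_d2 e k q).
Proof.
rewrite /d1_rem /pow_rem !qpow_d1_left [qpow_d2 e k.+1 q]/=.
set p := h *: e + q; set P := p ^+ k; set Q := q ^+ k; set D := qpow_d1 e k q.
set D' := qpow_d1 e k p; set D2 := qpow_d2 e k q.
have pD : p * D = h *: (e * D) + q * D by rewrite mulrDl scalerAl.
have pD2 : p * (h *: D2) = h ^+ 2 *: (e * D2) + h *: (q * D2).
  by rewrite mulrDl -scalerAl -!scalerAr scalerA expr2.
rewrite !mulrBr pD pD2 -[e * (h *: D)]scalerAr.
move: (e * P) (p * D') (e * Q) (q * D) (e * D) (q * D2) (e * D2).
move=> x1 x2 x3 x4 x5 x6 x7.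
by apply/rowP => i; rewrite !mxE; ring.
Qed.

Section Bounds.
Variables (e : quat R) (rho m : R).
Hypotheses (e1 : qabs e <= 1) (m0 : 0 < m).

(** Induction step common to the four estimates below.  They are Cauchy
    estimates: enlarging the radius from [rho] to [rho + m] absorbs the
    polynomial growth in [k] of the derivatives of [q ^+ k], at the cost of one
    factor [m^-1] per derivative. *)
Lemma bound_step (c1 c2 A B D : R) k : 0 <= rho ->
  0 <= c1 -> A <= c1 * (rho + m) ^+ k -> B <= rho * (c2 * (rho + m) ^+ k) ->
  c1 = m * c2 -> D <= A + B -> D <= c2 * (rho + m) ^+ k.+1.
Proof.
move=> rho0 c10 A1 B1 c12 DAB; rewrite (le_trans DAB)// (le_trans (lerD A1 B1))//.
by rewrite c12 exprS le_eqVlt; apply/orP; left; apply/eqP; ring.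
Qed.

Lemma qpow_d1_bound k q : qabs q <= rho ->
  qabs (qpow_d1 e k q) <= m^-1 * (rho + m) ^+ k.
Proof.
move=> qr; have r0 : 0 <= rho := le_trans (qabs_ge0 q) qr.
elim: k => [|k IH]; first by rewrite qabs0 mulr1 invr_ge0 ltW.
rewrite qpow_d1_left.
apply: (@bound_step 1 _ (qabs (e * q ^+ k)) (qabs (q * qpow_d1 e k q))) => //.
- rewrite mul1r qabsM qabsX -[leRHS]mul1r ler_pM ?qabs_ge0 ?exprn_ge0 ?qabs_ge0//.
  by rewrite lerXn2r ?nnegrE ?qabs_ge0 ?addr_ge0 ?(ltW m0)// ler_wpDr// ltW.
- by rewrite qabsM ler_pM ?qabs_ge0.
- by rewrite divff// gt_eqF.
- exact: qabsD.
Qed.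

Lemma qpow_d2_bound k q : qabs q <= rho ->
  qabs (qpow_d2 e k q) <= 2 * m ^- 2 * (rho + m) ^+ k.
Proof.
move=> qr; have r0 : 0 <= rho := le_trans (qabs_ge0 q) qr.
elim: k => [|k IH]; first by rewrite qabs0 mulr1 mulr_ge0// invr_ge0 exprn_ge0// ltW.
apply: (@bound_step (2 * m^-1) _ (qabs (2 *: (e * qpow_d1 e k q)))
  (qabs (q * qpow_d2 e k q))) => //.
- by rewrite mulr_ge0// invr_ge0 ltW.
- rewrite qabsZ ger0_norm// qabsM -mulrA ler_pM2l// -[leRHS]mul1r.
  by rewrite ler_pM ?qabs_ge0// qpow_d1_bound.
- by rewrite qabsM ler_pM ?qabs_ge0.
- by field; rewrite gt_eqF.
- exact: qabsD.
Qed.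

Lemma pow_rem_bound k q h : qabs q <= rho -> qabs (h *: e + q) <= rho ->
  qabs (pow_rem e k q h) <= h ^+ 2 * m ^- 2 * (rho + m) ^+ k.
Proof.
move=> qr hqr; have r0 : 0 <= rho := le_trans (qabs_ge0 q) qr.
have h20 : 0 <= h ^+ 2 by exact: sqr_ge0.
elim: k => [|k IH].
  rewrite /pow_rem /= !expr0 subrr scaler0 subr0 qabs0 mulr1.
  by rewrite mulr_ge0// invr_ge0 exprn_ge0// ltW.
rewrite pow_remS addrC.
apply: (@bound_step (h ^+ 2 * m^-1) _ (qabs (h ^+ 2 *: (e * qpow_d1 e k q)))
  (qabs ((h *: e + q) * pow_rem e k q h))) => //.
- by rewrite mulr_ge0// invr_ge0 ltW.
- rewrite qabsZ ger0_norm// qabsM -mulrA ler_wpM2l// -[leRHS]mul1r.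
  by rewrite ler_pM ?qabs_ge0// qpow_d1_bound.
- by rewrite qabsM ler_pM ?qabs_ge0.
- by field; rewrite gt_eqF.
- exact: qabsD.
Qed.

Lemma d1_rem_bound k q h : qabs q <= rho -> qabs (h *: e + q) <= rho ->
  qabs (d1_rem e k q h) <= 3 * h ^+ 2 * m ^- 3 * (rho + m) ^+ k.
Proof.
move=> qr hqr; have r0 : 0 <= rho := le_trans (qabs_ge0 q) qr.
have h20 : 0 <= h ^+ 2 by exact: sqr_ge0.
elim: k => [|k IH].
  rewrite /d1_rem /= subrr scaler0 subr0 qabs0 mulr1.
  by apply: divr_ge0; [exact: mulr_ge0 | rewrite exprn_ge0// ltW].
rewrite d1_remS -addrA addrC.
apply: (@bound_step (3 * h ^+ 2 * m ^- 2) _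
  (qabs (e * pow_rem e k q h + h ^+ 2 *: (e * qpow_d2 e k q)))
  (qabs ((h *: e + q) * d1_rem e k q h))) => //.
- by apply: divr_ge0; [exact: mulr_ge0 | rewrite exprn_ge0// ltW].
- have -> : 3 * h ^+ 2 * m ^- 2 * (rho + m) ^+ k =
      1 * (h ^+ 2 * m ^- 2 * (rho + m) ^+ k)
      + h ^+ 2 * (1 * (2 * m ^- 2 * (rho + m) ^+ k)) by ring.
  rewrite (le_trans (qabsD _ _))// qabsZ ger0_norm// !qabsM lerD//.
    by rewrite ler_pM ?qabs_ge0// pow_rem_bound.
  by rewrite ler_wpM2l// ler_pM ?qabs_ge0// qpow_d2_bound.
- by rewrite qabsM ler_pM ?qabs_ge0.
- by field; rewrite gt_eqF.
- exact: qabsD.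
Qed.

End Bounds.

(** The sum over the four basis directions collapses because
    [sum_basis_sandwich] turns each [q ^+ i] met between two occurrences of a
    basis vector into a conjugate power. *)
Lemma sum_basis_qpow_d1 k q :
  \sum_(i < 4) qbasis R i * qpow_d1 (qbasis R i) k.+1 q
  = (- 2) *: conj_sum k q.
Proof.
elim: k => [|k IH].
  under eq_bigr do rewrite /= mul0r add0r expr0 mul1r -[qbasis R _ in X in X * _]mulr1.
  by rewrite sum_basis_sandwich conj_sum0; have := @qconj_real R 1; rewrite scale1r => ->.
under eq_bigr => i _.
  rewrite -[qpow_d1 _ _ _]/(qpow_d1 _ k.+1 q * q + q ^+ k.+1 * _) mulrDr !mulrA.
  over.
rewrite big_split/= -mulr_suml IH sum_basis_sandwich qconjX conj_sumS.
by rewrite scalerDr -scalerAl comm_conj_sum.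
Qed.

Lemma sum_basis_qpow_d2 k q :
  \sum_(i < 4) qpow_d2 (qbasis R i) k.+2 q = (- 4) *: conj_wsum k q.
Proof.
have d2S n : \sum_(i < 4) qpow_d2 (qbasis R i) n.+2 q = (- 4) *: conj_sum n q
    + q * \sum_(i < 4) qpow_d2 (qbasis R i) n.+1 q.
  rewrite mulr_sumr; under eq_bigr => i _.
    rewrite -[qpow_d2 _ _ _]/(2 *: (_ * qpow_d1 _ n.+1 q) + q * qpow_d2 _ n.+1 q).
    over.
  rewrite big_split/= -scaler_sumr sum_basis_qpow_d1 scalerA.
  by congr (_ *: _ + _); ring.
elim: k => [|k IH]; last first.
  by rewrite d2S IH conj_wsumS scalerDr scalerAr addrC.
rewrite d2S conj_wsum0 conj_sum0 big1 ?mulr0 ?addr0// => i _.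
by rewrite /= !mulr0 scaler0 addr0.
Qed.

Lemma sum_basis_qpow_d2_fueter_Q k q :
  \sum_(i < 4) qpow_d2 (qbasis R i) k.+2 q
  = - (2 * k.+1%:R * k.+2%:R) *: fueter_Q k q.
Proof.
rewrite sum_basis_qpow_d2 fueter_QE scalerA; congr (_ *: _).
have : k.+1%:R * k.+2%:R != 0 :> R by rewrite mulf_neq0 ?pnatr_eq0.
by rewrite -mulrA; move: (k.+1%:R * _) => N N0; field.
Qed.

End PowerDerivatives.

(** * Termwise action of the Fueter map *)

Section QuaternionicSeries.
Variable R : realType.
Implicit Types (Omega : set (quat R)) (f : quat R -> quat R)
  (a : nat -> quat R) (q e p : quat R) (r s K d h : R) (k n : nat).

Lemma series_terms_bounded (u : nat -> quat R) : cvgn (series u) ->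
  exists M, forall k, qabs (u k) <= M.
Proof.
move=> /cvg_series_cvg_0 u0.
have /cvg_seq_bounded [M [_ uM]] : cvgn u by apply/cvg_ex; exists 0.
exists (2 * (M + 1)) => k; rewrite (le_trans (qabs_le_norm _))// ler_pM2l//.
by apply: uM => //; rewrite ltrDl.
Qed.

Lemma coef_bounded_le s r a : 0 <= r -> r <= s ->
  coef_bounded s a -> coef_bounded r a.
Proof.
move=> r0 rs [M aM]; exists M => k; apply: le_trans (aM k).
by rewrite ler_wpM2l// lerXn2r// nnegrE// (le_trans r0).
Qed.

Lemma quat_series_bound s r a : coef_bounded s a -> 0 <= r -> r < s ->
  exists C : R, forall K (w : nat -> quat R),
    (forall k, qabs (w k) <= K * r ^+ k) ->
    cvgn (series (fun k => w k * a k)) /\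
    forall n, `|series (fun k => w k * a k) n| <= K * C.
Proof.
move=> [M aM] r0 rs; have s0 : 0 < s by exact: le_lt_trans rs.
exists (2 * M / (1 - r / s)) => K w wK.
have K0 : 0 <= K.
  by have := wK 0%N; rewrite expr0 mulr1; apply: le_trans; exact: qabs_ge0.
have H k : `|w k * a k| <= K * (2 * M) * (r / s) ^+ k.
  rewrite (le_trans (norm_mul_le _ _))//.
  apply: (@le_trans _ _ (K * r ^+ k * (2 * `|a k|))).
    by rewrite ler_pM ?qabs_ge0// qabs_le_norm.
  have -> : K * r ^+ k * (2 * `|a k|) = K * 2 * r ^+ k * `|a k| by ring.
  have -> : K * (2 * M) * (r / s) ^+ k = K * 2 * r ^+ k * (M / s ^+ k).
    by rewrite expr_div_n; ring.
  apply: ler_wpM2l; first by rewrite !mulr_ge0// exprn_ge0.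
  by rewrite ler_pdivlMr ?exprn_gt0.
have rs0 : 0 <= r / s by rewrite divr_ge0// ltW.
have rs1 : r / s < 1 by rewrite ltr_pdivrMr// mul1r.
have [cw wle] := geometric_dominated_series rs0 rs1 H.
by split=> // n; rewrite !mulrA -[K * 2 * M]mulrA.
Qed.

(** Term-by-term differentiation along [e]: the quadratic Taylor remainders of
    the factors [phi k] are summable against the coefficients, uniformly in the
    increment. *)
Lemma termwise_is_derive s r d K a (phi psi : nat -> quat R -> quat R) f q e :
    coef_bounded s a -> 0 <= r -> r < s -> 0 < d ->
    (forall k, qabs (psi k q) <= K * r ^+ k) ->
    (forall h, `|h| < d ->
       series (fun k => phi k (h *: e + q) * a k) @ \oo --> f (h *: e + q)) ->
    (forall h k, `|h| < d -> qabs (phi k (h *: e + q) - phi k q - h *: psi k q)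
       <= K * h ^+ 2 * r ^+ k) ->
  cvgn (series (fun k => psi k q * a k)) /\
  is_derive q e f (limn (series (fun k => psi k q * a k))).
Proof.
move=> abd r0 rs d0 psiK phif remK.
have [C aC] := quat_series_bound abd r0 rs.
have [psi_cvg _] := aC _ _ psiK; split; first exact: psi_cvg.
apply: (@is_derive_quadratic _ _ _ _ _ _ _ (K * C) d) => // h hd.
have phiq : series (fun k => phi k q * a k) @ \oo --> f q.
  by have := phif 0; rewrite scale0r add0r normr0; exact.
pose rem k := (phi k (h *: e + q) - phi k q - h *: psi k q) * a k.
have [_ rem_le] := aC _ _ (fun k => remK h k hd).
rewrite mulrAC; apply: norm_lim_le rem_le.
have -> : series rem = fun n => series (fun k => phi k (h *: e + q) * a k) n
    - series (fun k => phi k q * a k) n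
    - h *: series (fun k => psi k q * a k) n.
  apply/funext => n; rewrite /series/= scaler_sumr -!sumrB.
  by apply: eq_bigr => k _; rewrite /rem !mulrBl scalerAl.
apply: cvgB; first by apply: cvgB => //; exact: phif.
by apply: cvgZ => //; exact: cvg_cst.
Qed.

Lemma open_qabs_ball Omega q : open Omega -> Omega q ->
  exists2 d, 0 < d & forall p, qabs p < d -> Omega (p + q).
Proof.
move=> Oo Oq; have /nbhs_ballP [d /= d0 dO] := open_nbhs_nbhs (conj Oo Oq).
exists d => // p pd; apply: dO; rewrite -ball_normE /=.
by rewrite opprD addrCA subrr addr0 normrN (le_lt_trans (norm_le_qabs _)).
Qed.

(** A point is moved away from the origin by adding a small real number having
    the sign of its real part. *)
Lemma open_larger_qabs Omega q : open Omega -> Omega q ->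
  exists2 p, Omega p & qabs q < qabs p.
Proof.
move=> Oo Oq; have [d d0 dO] := open_qabs_ball Oo Oq.
pose t := if 0 <= qcoord q 0 then d / 2 else - (d / 2).
have tn : `|t| = d / 2.
  by rewrite /t; case: ifP => _; rewrite ?normrN ger0_norm// divr_ge0// ltW.
exists (t%:A + q).
  by apply: dO; rewrite qabs_real tn ltr_pdivrMr// mulr_natr mulr2n ltrDl.
rewrite -(@ltr_pXn2r _ 2) ?nnegrE ?qabs_ge0// !qabs_sqr !qcoordD !qcoordZ.
rewrite qoneE !qcoord_mk //= !mulr0 !add0r mulr1.
have tq : 0 <= t * qcoord q 0.
  rewrite /t; case: ifPn => [q0|]; first by rewrite mulr_ge0// divr_ge0// ltW.
  by rewrite -ltNge => q0; rewrite mulNr -mulrN mulr_ge0 ?divr_ge0 ?oppr_ge0 ?ltW.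
have t2 : 0 < t ^+ 2 by rewrite -real_normK ?num_real// tn exprn_gt0// divr_gt0.
by rewrite sqrrD; lra.
Qed.

Lemma qpow_coef_bounded Omega f a q :
  expands_on Omega (@qpow R) f a -> Omega q -> coef_bounded (qabs q) a.
Proof.
move=> fa Oq.
have [|M qM] := @series_terms_bounded (fun k => qpow k q * a k).
  by apply/cvg_ex; exists (f q); exact: fa.
exists M => k; apply: le_trans (qM k).
by rewrite qabsM /qpow qabsX mulrC ler_wpM2l ?norm_le_qabs// exprn_ge0// qabs_ge0.
Qed.

Lemma qpow_series_cvg s a q : coef_bounded s a -> qabs q < s ->
  cvgn (series (fun k => qpow k q * a k)).
Proof.
move=> abd qs; have [C aC] := quat_series_bound abd (qabs_ge0 q) qs.
by apply: (proj1 (aC 1 _ _)) => k; rewrite /qpow qabsX mul1r.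
Qed.

Section FueterMap.
Variables (Omega : set (quat R)) (f : quat R -> quat R) (a : nat -> quat R).
Hypotheses (Oo : open Omega) (fa : expands_on Omega (@qpow R) f a).

(** The factor 3 leaves room for the increment, for the enlargement of the radius
    in the bounds on the derivatives of the powers, and for a strict inequality. *)
Lemma increment_room q : Omega q -> exists d,
  [/\ 0 < d, coef_bounded (qabs q + 3 * d) a &
      forall p, qabs p < d -> Omega (p + q)].
Proof.
move=> Oq; have [d d0 dO] := open_qabs_ball Oo Oq.
have [p Op qp] := open_larger_qabs Oo Oq.
pose m := Num.min d ((qabs p - qabs q) / 3).
have m0 : 0 < m by rewrite lt_min d0 divr_gt0// subr_gt0.
have mp : m <= (qabs p - qabs q) / 3 by rewrite ge_min lexx orbT.
exists m; split=> //.
  apply: coef_bounded_le (qpow_coef_bounded fa Op).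
    by rewrite addr_ge0 ?qabs_ge0// mulr_ge0// ltW.
  by lra.
by move=> t tm; apply: dO; rewrite (lt_le_trans tm)// ge_min lexx.
Qed.

Lemma qabs_increment_le h e q d : qabs e <= 1 -> `|h| < d ->
  qabs (h *: e) < d /\ qabs (h *: e + q) <= qabs q + d.
Proof.
move=> e1 hd; have hed : qabs (h *: e) < d.
  by rewrite qabsZ (le_lt_trans _ hd)// ler_piMr.
by split=> //; rewrite (le_trans (qabsD _ _))// addrC lerD2l ltW.
Qed.

Lemma is_derive_qpow_series q e : Omega q -> qabs e <= 1 ->
  cvgn (series (fun k => qpow_d1 e k q * a k)) /\
  is_derive q e f (limn (series (fun k => qpow_d1 e k q * a k))).
Proof.
move=> Oq e1; have [d [d0 abd dO]] := increment_room Oq.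
have q0 := qabs_ge0 q; have qd : qabs q <= qabs q + d by rewrite lerDl ltW.
pose K := Num.max d^-1 (d ^- 2).
apply: (@termwise_is_derive (qabs q + 3 * d) (qabs q + d + d) d K _
  (@qpow R) (qpow_d1 e)) => //.
- by lra.
- by lra.
- move=> k; rewrite (le_trans (qpow_d1_bound e1 d0 k qd))// ler_wpM2r//.
    by rewrite exprn_ge0//; lra.
  by rewrite le_max lexx.
- by move=> h hd; apply: fa; apply: dO; have [] := qabs_increment_le q e1 hd.
- move=> h k hd; have [_ hq] := qabs_increment_le q e1 hd.
  rewrite (le_trans (pow_rem_bound e1 d0 k qd hq))// ler_wpM2r//.
    by rewrite exprn_ge0//; lra.
  by rewrite [leRHS]mulrC ler_wpM2l ?sqr_ge0// le_max lexx orbT.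
Qed.

Lemma is_derive2_qpow_series q e : Omega q -> qabs e <= 1 ->
  cvgn (series (fun k => qpow_d2 e k q * a k)) /\
  is_derive q e ('D_e f) (limn (series (fun k => qpow_d2 e k q * a k))).
Proof.
move=> Oq e1; have [d [d0 abd dO]] := increment_room Oq.
have q0 := qabs_ge0 q; have qd : qabs q <= qabs q + d by rewrite lerDl ltW.
pose K := Num.max (2 * d ^- 2) (3 * d ^- 3).
apply: (@termwise_is_derive (qabs q + 3 * d) (qabs q + d + d) d K _
  (qpow_d1 e) (qpow_d2 e)) => //.
- by lra.
- by lra.
- move=> k; rewrite (le_trans (qpow_d2_bound e1 d0 k qd))// ler_wpM2r//.
    by rewrite exprn_ge0//; lra.
  by rewrite le_max lexx.
- move=> h hd; have Oh : Omega (h *: e + q).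
    by apply: dO; have [] := qabs_increment_le q e1 hd.
  by have [c1 /@derive_val ->] := is_derive_qpow_series Oh e1.
- move=> h k hd; have [_ hq] := qabs_increment_le q e1 hd.
  rewrite (le_trans (d1_rem_bound e1 d0 k qd hq))// ler_wpM2r//.
    by rewrite exprn_ge0//; lra.
  by rewrite mulrAC ler_wpM2r ?sqr_ge0// le_max lexx orbT.
Qed.

Lemma fueter_defined_on_expands : fueter_defined_on Omega f.
Proof.
move=> q i Oq; have e1 : qabs (qbasis R i) <= 1 by rewrite qabs_basis.
by split; [have [_ []] := is_derive_qpow_series Oq e1
          | have [_ []] := is_derive2_qpow_series Oq e1].
Qed.

Definition fueter_coef (b : nat -> quat R) k : quat R :=
  - (2 * k.+1%:R * k.+2%:R) *: b k.+2.

(** The Laplacians of [1] and [q] vanish, hence the shift of the index by 2. *)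
Lemma fueter_map_expands :
  expands_on Omega (@fueter_Q R) (fueter_map f) (fueter_coef a).
Proof.
move=> q Oq; pose lap k := \sum_(i < 4) qpow_d2 (qbasis R i) k q.
have -> : series (fun k => fueter_Q k q * fueter_coef a k) =
    [sequence series (fun k => lap k * a k) (n + 2)%N]_n.
  apply/funext => n; rewrite /series/= addn2 !big_mkord.
  have lap0 : lap 0%N = 0 by rewrite /lap big1.
  have lap1 : lap 1%N = 0.
    by rewrite /lap big1// => i _; rewrite /= !mulr0 scaler0 addr0.
  rewrite !big_ord_recl/= -[lap (bump 0 0)]/(lap 1%N) lap0 lap1 !mul0r !add0r.
  apply: eq_bigr => k _; rewrite -[lap _]/(lap k.+2) /lap /fueter_coef.
  by rewrite sum_basis_qpow_d2_fueter_Q -scalerAr scalerAl.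
rewrite cvg_shiftn.
have -> : series (fun k => lap k * a k) = fun n =>
    \sum_(i < 4) series (fun k => qpow_d2 (qbasis R i) k q * a k) n.
  apply/funext => n; rewrite /series/= exchange_big/=.
  by apply: eq_bigr => k _; rewrite /lap mulr_suml.
apply: cvg_big => [|i _]; first exact: add_continuous.
have e1 : qabs (qbasis R i) <= 1 by rewrite qabs_basis.
by have [cD /@derive_val ->] := is_derive2_qpow_series Oq e1.
Qed.

End FueterMap.

(** * Uniqueness of coefficients and linear structure *)

(** Both families of basis functions restrict to [x ^+ k] on the real line, so
    one uniqueness statement serves for both. *)
Definition real_monomial (b : nat -> quat R -> quat R) :=
  forall k (x : R), b k x%:A = (x ^+ k)%:A.

Lemma qpow_real_monomial : real_monomial (@qpow R).
Proof. by move=> k x; exact: realX. Qed.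

Lemma fueter_Q_real_monomial : real_monomial (@fueter_Q R).
Proof. by move=> k x; exact: fueter_Q_real. Qed.

Lemma coefs_unique Omega b f a a' : open Omega ->
    Omega `&` @real_line R !=set0 -> real_monomial b ->
    expands_on Omega b f a -> expands_on Omega b f a' -> a = a'.
Proof.
move=> Oo [y0 [Ox0 [x y0E]]] bX fa fa'; rewrite {}y0E in Ox0.
have [d d0 dO] := open_qabs_ball Oo Ox0.
have near_real y : `|y - x| < d -> Omega y%:A.
  move=> yx; have -> : y%:A = (y - x)%:A + x%:A :> quat R.
    by rewrite -scalerDl subrK.
  by apply: dO; rewrite qabs_real.
pose c k := a k - a' k.
have c0 y : `|y - x| < d -> series (fun k => y ^+ k *: c k) @ \oo --> (0 : quat R).
  move=> yx; have Oy := near_real y yx.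
  have -> : series (fun k => y ^+ k *: c k) = fun n =>
      series (fun k => b k y%:A * a k) n - series (fun k => b k y%:A * a' k) n.
    apply/funext => n; rewrite /series/= -sumrB; apply: eq_bigr => k _.
    by rewrite -mulrBr bX -scalerAl mul1r.
  by rewrite -(subrr (f y%:A)); apply: cvgB; [exact: fa | exact: fa'].
(* A second real point [x + t] of larger modulus provides the bound on the
   coefficients that the identity theorem needs at [x]. *)
pose t := if 0 <= x then d / 2 else - (d / 2).
have tn : `|t| = d / 2.
  by rewrite /t; case: ifP => _; rewrite ?normrN ger0_norm// divr_ge0// ltW.
have xt : `|x| < `|x + t|.
  rewrite /t; case: ifPn => [x0|].
    by rewrite !ger0_norm ?addr_ge0 ?divr_ge0 ?(ltW d0)//; lra.
  by rewrite -ltNge => x0; rewrite !ltr0_norm //; lra.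
have cbd : coef_bounded `|x + t| c.
  have yt : `|x + t - x| < d by rewrite addrC addKr tn; lra.
  have [|M cM] := @series_terms_bounded (fun k => (x + t) ^+ k *: c k).
    by apply/cvg_ex; exists 0; exact: c0.
  exists M => k; apply: le_trans (cM k); apply: le_trans (norm_le_qabs _).
  by rewrite normrZ normrX mulrC.
have : forall n, c n = 0.
  apply: (power_series_identity cbd xt).
  exists d => //= y /= xy; by apply: c0; rewrite distrC.
by move=> cE; apply/funext => n; apply/eqP; rewrite -subr_eq0; apply/eqP/cE.
Qed.

Lemma coefs_expands Omega b f a : open Omega ->
    Omega `&` @real_line R !=set0 -> real_monomial b ->
  expands_on Omega b f a -> coefs Omega b f = a.
Proof.
move=> Oo OR bX fa; apply: (coefs_unique Oo OR bX _ fa).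
by rewrite /coefs; case: xgetP => [x _ //|/(_ a)].
Qed.

Lemma cvg_qmulr (u : nat -> quat R) (l p : quat R) :
  u @ \oo --> l -> (fun n => u n * p) @ \oo --> l * p.
Proof.
move=> ul; apply/cvgrPdist_le => e e0.
have C0 : 0 < 2 * qabs p + 1 by rewrite ltr_wpDl// mulr_ge0// qabs_ge0.
near=> n.
have un : `|l - u n| <= e / (2 * qabs p + 1).
  near: n; move/cvgrPdist_le: ul; apply; exact: divr_gt0.
rewrite -mulrBl (le_trans (norm_mul_le _ _))//.
apply: (@le_trans _ _ ((2 * qabs p + 1) * `|l - u n|)).
  have := qabs_le_norm (l - u n); have := qabs_ge0 p; have := normr_ge0 (l - u n).
  by nra.
by rewrite mulrC -ler_pdivlMr.
Unshelve. all: by end_near. Qed.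

Lemma expands_on_lin Omega b f g a c p :
  expands_on Omega b f a -> expands_on Omega b g c ->
  expands_on Omega b (fun q => f q * p + g q) (fun k => a k * p + c k).
Proof.
move=> fa gc q Oq.
have -> : series (fun k => b k q * (a k * p + c k)) = fun n =>
    series (fun k => b k q * a k) n * p + series (fun k => b k q * c k) n.
  apply/funext => n; rewrite /series/= mulr_suml -big_split/=.
  by apply: eq_bigr => k _; rewrite mulrDr mulrA.
by apply: cvgD; [apply: cvg_qmulr; exact: fa | exact: gc].
Qed.

Lemma expands_on0 Omega b : expands_on Omega b (fun=> 0) (fun=> 0).
Proof.
move=> q _; have -> : series (fun k => b k q * 0) = fun=> 0.
  by apply/funext => n; rewrite /series/= big1// => k _; rewrite mulr0.
exact: cvg_cst.
Qed.

Lemma wterm_ge0 (w : nat -> R) a k : (forall n, 0 <= w n) -> 0 <= wterm w a k.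
Proof. by move=> w0; rewrite /wterm mulr_ge0// sqr_ge0. Qed.

(** By [qabs (x + y) ^+ 2 <= 2 * qabs x ^+ 2 + 2 * qabs y ^+ 2]. *)
Lemma wseries_lin (w : nat -> R) a c p : (forall n, 0 <= w n) ->
  cvgn (series (wterm w a)) -> cvgn (series (wterm w c)) ->
  cvgn (series (wterm w (fun k => a k * p + c k))).
Proof.
move=> w0 wa wc.
apply: (@series_le_cvg _ _ (fun k => 2 * qabs p ^+ 2 * wterm w a k
    + 2 * wterm w c k)).
- by move=> n; exact: wterm_ge0.
- move=> n; apply: addr_ge0; apply: mulr_ge0; rewrite ?wterm_ge0//.
- move=> n; rewrite /wterm.
  have -> : 2 * qabs p ^+ 2 * (w n * qabs (a n) ^+ 2)
      + 2 * (w n * qabs (c n) ^+ 2)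
    = w n * (2 * qabs (a n * p) ^+ 2 + 2 * qabs (c n) ^+ 2).
    by rewrite qabsM; ring.
  rewrite ler_wpM2l//; have := qabsD (a n * p) (c n).
  have := qabs_ge0 (a n * p + c n); have := qabs_ge0 (a n * p).
  have := qabs_ge0 (c n).
  move: (qabs (a n * p + c n)) (qabs (a n * p)) (qabs (c n)) => x y z.
  by move=> z0 y0 x0 xyz; have := sqr_ge0 (y - z); nra.
have -> : series (fun k => 2 * qabs p ^+ 2 * wterm w a k + 2 * wterm w c k) =
    fun n => 2 * qabs p ^+ 2 * series (wterm w a) n + 2 * series (wterm w c) n.
  by apply/funext => n; rewrite /series/= !mulr_sumr -big_split.
apply: is_cvgD; apply: is_cvgM => //; exact: is_cvg_cst.
Qed.

Lemma right_subspace_weighted Omega b (w : nat -> R) : (forall n, 0 <= w n) ->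
  right_subspace (weighted_space Omega b w).
Proof.
move=> w0; split.
  exists (fun=> 0); first exact: expands_on0.
  have -> : series (wterm w (fun=> 0 : quat R)) = fun=> 0.
    apply/funext => n; rewrite /series/= big1// => k _.
    by rewrite /wterm qabs0 expr0n mulr0.
  exact: is_cvg_cst.
move=> f g p [a fa wa] [c gc wc].
by exists (fun k => a k * p + c k); [exact: expands_on_lin | exact: wseries_lin].
Qed.

End QuaternionicSeries.

(** * The isometry *)

Section FueterIsometry.
Variables (R : realType) (Omega : set (quat R)) (c : nat -> R).
Hypotheses (Oo : open Omega) (OR : Omega `&` @real_line R !=set0).
Hypothesis c_gt0 : forall k, 0 < c k.
Implicit Types (f g : quat R -> quat R) (a b : nat -> quat R) (p q : quat R).

Lemma qpow_coefs f a :
  expands_on Omega (@qpow R) f a -> coefs Omega (@qpow R) f = a.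
Proof. by apply: coefs_expands => //; exact: qpow_real_monomial. Qed.

Lemma fueter_Q_coefs f a :
  expands_on Omega (@fueter_Q R) f a -> coefs Omega (@fueter_Q R) f = a.
Proof. by apply: coefs_expands => //; exact: fueter_Q_real_monomial. Qed.

Lemma HS0P f : HS0 c Omega f <->
  exists a, [/\ expands_on Omega (@qpow R) f a, cvgn (series (wterm c a)),
                a 0%N = 0 & a 1%N = 0].
Proof.
split=> [[[a fa ca]]|[a [fa ca a0 a1]]].
  by rewrite (qpow_coefs fa) => a0 a1; exists a.
by split; rewrite ?(qpow_coefs fa)//; exists a.
Qed.

(** Both norms are weighted sums of squares of coefficients, and the factor
    [2 * k.+1 * k.+2] in [fueter_coef] cancels the denominator of
    [fueter_weight] up to [4]. *)
Lemma wterm_fueter_coef a k :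
  wterm (fueter_weight c) (fueter_coef a) k = 4 * wterm c a k.+2.
Proof.
rewrite /wterm /fueter_weight /fueter_coef qabsZ normrN ger0_norm; last first.
  by rewrite !mulr_ge0.
have : k.+1%:R * k.+2%:R != 0 :> R by rewrite mulf_neq0 ?pnatr_eq0.
rewrite -exprMn -[2 * _ * _]mulrA; move: (k.+1%:R * _) => N N0.
by field.
Qed.

Lemma wseries_fueter_coef a : a 0%N = 0 -> a 1%N = 0 ->
  series (wterm (fueter_weight c) (fueter_coef a)) =
  [sequence 4 * series (wterm c a) (n + 2)%N]_n.
Proof.
move=> a0 a1; apply/funext => n; rewrite /series/= addn2 !big_mkord.
have w0 k : a k = 0 -> wterm c a k = 0.
  by move=> ak0; rewrite /wterm ak0 qabs0 expr0n mulr0.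
rewrite 2!big_ord_recl/= -[wterm c a (bump 0 0)]/(wterm c a 1%N).
rewrite (w0 _ a0) (w0 _ a1) !add0r mulr_sumr.
by apply: eq_bigr => k _; rewrite wterm_fueter_coef.
Qed.

Lemma cvg_wseries_fueter_coef a (l : R) : a 0%N = 0 -> a 1%N = 0 ->
  series (wterm c a) @ \oo --> l ->
  series (wterm (fueter_weight c) (fueter_coef a)) @ \oo --> 4 * l.
Proof.
move=> a0 a1 al; rewrite wseries_fueter_coef//.
by apply: cvgM; [exact: cvg_cst | rewrite cvg_shiftn].
Qed.

Lemma fueter_weight_ge0 k : 0 <= fueter_weight c k.
Proof. by rewrite /fueter_weight divr_ge0// ?mulr_ge0 ?exprn_ge0// ltW. Qed.

Lemma fueter_HM f : HS0 c Omega f ->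
  HM (fueter_weight c) Omega (fueter_map f).
Proof.
move=> /HS0P[a [fa ca a0 a1]]; exists (fueter_coef a).
  exact: fueter_map_expands.
by apply/cvg_ex; eexists; exact: cvg_wseries_fueter_coef ca.
Qed.

Lemma fueter_map_norm f : HS0 c Omega f ->
  HM_norm (fueter_weight c) Omega (fueter_map f) = 2 * HS_norm c Omega f.
Proof.
move=> /HS0P[a [fa ca a0 a1]].
rewrite /HM_norm /HS_norm /weighted_norm (qpow_coefs fa).
rewrite (fueter_Q_coefs (fueter_map_expands Oo fa)).
rewrite (cvg_lim _ (cvg_wseries_fueter_coef a0 a1 ca))//.
rewrite sqrtrM//; congr (_ * _).
have -> : 4 = 2 ^+ 2 :> R by ring.
by rewrite sqrtr_sqr ger0_norm.
Qed.

Lemma HS0_lin f g p : HS0 c Omega f -> HS0 c Omega g ->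
  HS0 c Omega (fun q => f q * p + g q).
Proof.
move=> /HS0P[a [fa ca a0 a1]] /HS0P[b [gb cb b0 b1]].
apply/HS0P; exists (fun k => a k * p + b k); split.
- exact: expands_on_lin.
- by apply: wseries_lin => // k; exact: ltW.
- by rewrite a0 b0 mul0r addr0.
- by rewrite a1 b1 mul0r addr0.
Qed.

Lemma HS0_right_subspace : right_subspace (HS0 c Omega).
Proof.
split; last by move=> f g p; exact: HS0_lin.
apply/HS0P; exists (fun=> 0); split=> //; first exact: expands_on0.
have -> : series (wterm c (fun=> 0 : quat R)) = fun=> 0.
  apply/funext => n; rewrite /series/= big1// => k _.
  by rewrite /wterm qabs0 expr0n mulr0.
exact: is_cvg_cst.
Qed.

Lemma fueter_map_lin f g p q : HS0 c Omega f -> HS0 c Omega g -> Omega q ->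
  fueter_map (fun q => f q * p + g q) q = fueter_map f q * p + fueter_map g q.
Proof.
move=> /HS0P[a [fa _ _ _]] /HS0P[b [gb _ _ _]] Oq.
have fg := fueter_map_expands Oo (expands_on_lin (p := p) fa gb).
have fg' := expands_on_lin (p := p) (fueter_map_expands Oo fa)
  (fueter_map_expands Oo gb).
have coefE : fueter_coef (fun k => a k * p + b k) =
    fun k => fueter_coef a k * p + fueter_coef b k.
  by apply/funext => k; rewrite /fueter_coef scalerDr scalerAl.
rewrite coefE in fg.
exact: (cvg_unique (@norm_hausdorff _ _) (fg q Oq) (fg' q Oq)).
Qed.

Definition fueter_preimage_coef (b : nat -> quat R) (k : nat) : quat R :=
  if k is n.+2 then - (2 * n.+1%:R * n.+2%:R)^-1 *: b n else 0.

Lemma fueter_preimage_coefK b : fueter_coef (fueter_preimage_coef b) = b.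
Proof.
apply/funext => k; rewrite /fueter_coef /= scalerA mulrNN divff ?scale1r//.
Qed.

(** Convergence of the series in the [fueter_Q k] at [q] bounds the terms of the
    power series at the same point: by [fueter_Q_lower] the polynomial factor
    lost in passing from [q ^+ k.+2] to [fueter_Q k q] is no larger than the
    one gained by dividing the coefficients. *)
Lemma fueter_preimage_bounded b g q : expands_on Omega (@fueter_Q R) g b ->
  Omega q -> coef_bounded (qabs q) (fueter_preimage_coef b).
Proof.
move=> gb Oq.
(* [QK] holds from the rank [N] on only; the finitely many other terms are
   absorbed in the bound by their sum. *)
have [|M bM] := @series_terms_bounded R (fun k => fueter_Q k q * b k).
  by apply/cvg_ex; exists (g q); exact: gb.
have [K K0 [N _ QK]] := fueter_Q_lower q.
pose u k := `|fueter_preimage_coef b k| * qabs q ^+ k.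
have u0 k : 0 <= u k by rewrite mulr_ge0// exprn_ge0// qabs_ge0.
have M0 : 0 <= M := le_trans (qabs_ge0 _) (bM 0%N).
exists (\sum_(i < N.+2) u i + K * M) => k; rewrite -/(u k).
have [kN|Nk] := ltnP k N.+2.
  rewrite (bigD1 (Ordinal kN))//= -addrA lerDl addr_ge0 ?mulr_ge0//.
  by apply: sumr_ge0 => i _.
apply: ler_wpDl; first by apply: sumr_ge0 => i _.
case: k Nk => [//|[//|k]]; rewrite !ltnS => Nk; rewrite /u /=.
have QKk : qabs q ^+ k.+2 <= K * (k.+1%:R * k.+2%:R) * qabs (fueter_Q k q).
  exact: QK.
have n0 : 0 < k.+1%:R * k.+2%:R :> R by rewrite mulr_gt0.
rewrite -mulrA; move: QKk n0; move: (k.+1%:R * _) => n QKk n0.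
apply: le_trans (_ : (2 * n)^-1 * qabs (b k) * (K * n * qabs (fueter_Q k q)) <= _).
  apply: ler_pM => //; first by rewrite exprn_ge0// qabs_ge0.
  rewrite (le_trans (norm_le_qabs _))// qabsZ normrN ger0_norm//.
  by rewrite invr_ge0 mulr_ge0// ltW.
have -> : (2 * n)^-1 * qabs (b k) * (K * n * qabs (fueter_Q k q)) =
    K * qabs (fueter_Q k q * b k) / 2.
  by rewrite qabsM; field; rewrite gt_eqF.
have := ler_wpM2l K0 (bM k); have := mulr_ge0 K0 (qabs_ge0 (fueter_Q k q * b k)).
by lra.
Qed.

Lemma fueter_map_onto :
  onto_on Omega (HS0 c Omega) (HM (fueter_weight c) Omega) (@fueter_map R).
Proof.
move=> g [b gb wb]; pose a := fueter_preimage_coef b.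
pose f q := limn (series (fun k => qpow k q * a k)).
have fa : expands_on Omega (@qpow R) f a.
  move=> q Oq; have [p Op qp] := open_larger_qabs Oo Oq.
  exact: qpow_series_cvg (fueter_preimage_bounded gb Op) qp.
have ca : series (wterm c a) @ \oo -->
    4^-1 * limn (series (wterm (fueter_weight c) b)).
  rewrite -(cvg_shiftn 2).
  have -> : [sequence series (wterm c a) (n + 2)%N]_n =
      fun n => 4^-1 * series (wterm (fueter_weight c) b) n.
    apply/funext => n; rewrite -(fueter_preimage_coefK b).
    by rewrite wseries_fueter_coef//= mulKf.
  by apply: cvgM; [exact: cvg_cst | exact: wb].
exists f; first by apply/HS0P; exists a; split=> //; apply/cvg_ex; eexists; exact: ca.
move=> q Oq; have := fueter_map_expands Oo fa Oq.
rewrite fueter_preimage_coefK => fq.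
exact: (cvg_unique (@norm_hausdorff _ _) fq (gb q Oq)).
Qed.

End FueterIsometry.

Theorem corollary6p2 (R : realType) (Omega : set (quat R)) (c : nat -> R)
  (Omega_slice : slice_domain Omega) (Omega_axial : axially_symmetric Omega)
  (c_nondecreasing : nondecreasing_seq c) (c0 : c 0%N = 1) :
  [/\ forall f, HS0 c Omega f -> fueter_defined_on Omega f,
      right_linear_operator Omega (HS0 c Omega) (HM (fueter_weight c) Omega)
        (@fueter_map R),
      onto_on Omega (HS0 c Omega) (HM (fueter_weight c) Omega)
        (@fueter_map R) &
      exists C : R, 0 < C /\
        forall f, HS0 c Omega f ->
          HM_norm (fueter_weight c) Omega (fueter_map f)
          = C * HS_norm c Omega f].
Proof.
have [Oo _ OR _] := Omega_slice.
have c_gt0 k : 0 < c k by rewrite (lt_le_trans ltr01)// -c0 c_nondecreasing.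
split.
- by move=> f [[a fa _] _ _]; exact: (fueter_defined_on_expands Oo fa).
- split.
  + exact: HS0_right_subspace.
  + by apply: right_subspace_weighted => k; exact: fueter_weight_ge0.
  + by move=> f; exact: fueter_HM.
  + by move=> f g p ff gg q Oq; exact: (fueter_map_lin Oo OR p ff gg Oq).
- exact: fueter_map_onto.
- by exists 2; split=> // f; exact: fueter_map_norm.
Qed.
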